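(* Let $(K,\nu)$ be a valued field and $\omega$ a valuation transcendental extension of $\nu$ to $K(x)$. Take a pseudo-Cauchy sequence $(z_\mu)_{\mu<\lambda}$ in $(K,\nu)$ without a limit in $K$. Assume that $x$ is a limit of $(z_\mu)_{\mu<\lambda}$ (with respect to $\omega$). Then the following hold: (i) $(z_\mu)_{\mu<\lambda}$ is a pseudo-Cauchy sequence of algebraic type. (ii) Whenever $(a,\gamma)$ is a pair of definition for $\omega$, $a$ is a limit of $(z_\mu)_{\mu<\lambda}$. (iii) Let $Q(x)\in K[x]$ be a nonlinear key polynomial for $\omega$ with a maximal root $b\in\overline{K}$. Then $b$ is also a limit of $(z_\mu)_{\mu<\lambda}$. (iv) Take an associated minimal polynomial $m(x)\in K[x]$ of $(z_\mu)_{\mu<\lambda}$. Then $m(x)$ is a key polynomial for $\omega$. Conversely (without assuming that $x$ is a limit), assume that $(a,\gamma)$ is a minimal pair of definition for $\omega$ and that $a$ is a limit of $(z_\mu)_{\mu<\lambda}$. Then $x$ is also a limit of $(z_\mu)_{\mu<\lambda}$.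
   Context: Values are written additively, $\nu 0=\infty$; for a valued field $(L,\nu)$, $\nu L$ and $L\nu$ denote the value group and residue field. $\overline{K}$ is a fixed algebraic closure of $K$. An extension $\omega$ of $\nu$ to the rational function field $K(x)$ is value transcendental if $\dim_{\mathbb{Q}}\big((\omega K(x)/\nu K)\otimes_{\mathbb{Z}}\mathbb{Q}\big)=1$, residue transcendental if $\mathrm{trdeg}[K(x)\omega:K\nu]=1$, and valuation transcendental if it is one of these. Fix an extension $\overline{\nu}$ of $\nu$ to $\overline{K}$ and a common extension $\overline{\omega}$ of $\omega$ and $\overline{\nu}$ to $\overline{K}(x)$. For $a\in\overline{K}$ and $\gamma$ in an ordered abelian group containing $\overline{\nu}\,\overline{K}$, $\overline{\nu}_{a,\gamma}$ is the valuation on $\overline{K}(x)$ determined by $\overline{\nu}_{a,\gamma}\big(\sum_i c_i(x-a)^i\big)=\min_i\{\overline{\nu}c_i+i\gamma\}$ ($c_i\in\overline{K}$). A pair $(a,\gamma)$ with $a\in\overline{K}$, $\gamma\in\overline{\omega}\,\overline{K}(x)$ is a pair of definition for $\omega$ if $\overline{\omega}=\overline{\nu}_{a,\gamma}$; it is a minimal pair of definition if moreover for every $b\in\overline{K}$, $\overline{\nu}(a-b)\geq\gamma$ implies $[K(a):K]\leq[K(b):K]$. For nonconstant $f\in K[x]$, $\delta(f):=\max\{\overline{\omega}(x-c)\mid c\in\overline{K},\ f(c)=0\}$; a root $c$ of $f$ with $\overline{\omega}(x-c)=\delta(f)$ is a maximal root of $f$. A monic (nonconstant) $Q\in K[x]$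 is a key polynomial for $\omega$ (over $K$) if for every (nonconstant) $f\in K[x]$, $\deg f<\deg Q$ implies $\delta(f)<\delta(Q)$. A family $(z_\mu)_{\mu<\lambda}$ in $K$, $\lambda$ a limit ordinal, is a pseudo-Cauchy sequence if $\nu(z_{\mu_1}-z_{\mu_2})<\nu(z_{\mu_2}-z_{\mu_3})$ for all $\mu_1<\mu_2<\mu_3<\lambda$. An element $l$ of a valued field extension $(L,\nu)$ of $(K,\nu)$ is a limit of it if $\nu(l-z_\mu)=\nu(z_\mu-z_{\mu+1})$ for all $\mu<\lambda$ (for $l\in\overline{K}$ this is with respect to $\overline{\nu}$). For each $f\in K[x]$ the sequence $(\nu f(z_\mu))_{\mu<\lambda}$ is either ultimately constant or ultimately strictly increasing. The sequence is of transcendental type if $(\nu f(z_\mu))_{\mu<\lambda}$ is ultimately constant for all $f\in K[x]$, and of algebraic type otherwise; in the latter case an associated minimal polynomial is a monic $f\in K[x]$ of minimal degree such that $(\nu f(z_\mu))_{\mu<\lambda}$ is ultimately strictly increasing. *)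

(* Defs.v *)
From HB Require Import structures.
From mathcomp Require Import all_boot all_order all_algebra.
From mathcomp.classical Require Import boolp.
From mathcomp Require Import ring zify.
From mathcomp.multinomials Require mpoly.

Set Implicit Arguments.
Unset Strict Implicit.
Unset Printing Implicit Defensive.

Import Order.TTheory GRing.Theory Num.Theory.

Local Open Scope ring_scope.
Local Open Scope quotient_scope.

HB.mixin Record POrderedZmodule_isOrderedGroup G of Num.POrderedZmodule G := {
  og_le_total : total (<=%O : rel G);
  og_leD2l : forall z x y : G, x <= y -> z + x <= z + y
}.

#[short(type="orderedGroupType")]
HB.structure Definition OrderedGroup :=
  {G of Num.POrderedZmodule G & POrderedZmodule_isOrderedGroup G}.

Definition withtop (G : Type) : Type := option G.

Definition fin (G : Type) (g : G) : withtop G := Some g.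
Definition infty (G : Type) : withtop G := None.
Arguments infty {G}.

HB.instance Definition _ (G : choiceType) := Choice.on (withtop G).

Section WithTop.
Variable G : orderedGroupType.
Implicit Types x y z : withtop G.

Definition withtop_add x y : withtop G :=
  if x is Some g then if y is Some h then fin (g + h) else infty else infty.

Fact withtop_addA : associative withtop_add.
Proof. by case=> [g|] [h|] [k|] //=; rewrite addrA. Qed.
Fact withtop_addC : commutative withtop_add.
Proof. by case=> [g|] [h|] //=; rewrite addrC. Qed.
Fact withtop_add0 : left_id (fin 0) withtop_add.
Proof. by case=> [g|] //=; rewrite add0r. Qed.

HB.instance Definition _ := GRing.isNmodule.Build (withtop G)
  withtop_addA withtop_addC withtop_add0.

Definition withtop_le x y : bool :=
  if y is Some h then if x is Some g then g <= h else false else true.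

Fact withtop_le_refl : reflexive withtop_le.
Proof. by case=> /=. Qed.
Fact withtop_le_anti : antisymmetric withtop_le.
Proof. by case=> [g|] [h|] //= /le_anti ->. Qed.
Fact withtop_le_trans : transitive withtop_le.
Proof. by case=> [g|] [h|] [k|] //=; apply: le_trans. Qed.

HB.instance Definition _ := Order.Le_isPOrder.Build ring_display (withtop G)
  withtop_le_refl withtop_le_anti withtop_le_trans.

Fact withtop_le_total : total withtop_le.
Proof. by case=> [g|] [h|] //=; apply: og_le_total. Qed.

HB.instance Definition _ :=
  Order.POrder_isTotal.Build ring_display (withtop G) withtop_le_total.

End WithTop.

Lemma leD2l_withtop (G : orderedGroupType) (z x y : withtop G) :
  x <= y -> z + x <= z + y.
Proof. by case: x y z => [g|] [h|] [k|] //=; apply: og_leD2l. Qed.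

Lemma og_double_eq0 (G : orderedGroupType) (g : G) : g + g = 0 -> g = 0.
Proof.
move=> gg; have [g0|g0] := orP (og_le_total 0 g); apply: le_anti; rewrite g0.
  by move: (og_leD2l g _ _ g0); rewrite addr0 gg => ->.
by move: (og_leD2l g _ _ g0); rewrite addr0 gg => ->.
Qed.

Record valuation (F : fieldType) (G : orderedGroupType) := Valuation {
  valuation_fun :> F -> withtop G;
  valuation_infty : forall a, valuation_fun a = infty <-> a = 0;
  valuationM : forall a b, valuation_fun (a * b) = valuation_fun a + valuation_fun b;
  valuationD : forall a b,
    Num.min (valuation_fun a) (valuation_fun b) <= valuation_fun (a + b)
}.

Section ValuationTheory.
Variables (F : fieldType) (G : orderedGroupType) (v : valuation F G).

Lemma valuation0 : v 0 = infty. Proof. exact/valuation_infty. Qed.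

Lemma valuation_fin a : a != 0 -> exists g, v a = fin g.
Proof.
case E : (v a) => [g|] a0; first by exists g.
by move/valuation_infty: E a0 => ->; rewrite eqxx.
Qed.

Lemma valuation1 : v 1 = 0.
Proof.
have [g E] := valuation_fin (oner_neq0 F).
have := valuationM v 1 1; rewrite mulr1 E => -[] /(congr1 (fun h => h - g)).
by rewrite subrr addrK => <-.
Qed.

Lemma valuationN1 : v (-1) = 0.
Proof.
have /valuation_fin[g E] : -1 != 0 :> F by rewrite oppr_eq0 oner_eq0.
have := valuationM v (-1) (-1); rewrite mulrNN mulr1 valuation1 E => -[].
by move=> /esym/og_double_eq0 ->.
Qed.

Lemma valuationN a : v (- a) = v a.
Proof. by rewrite -mulN1r valuationM valuationN1 add0r. Qed.

Lemma valuationV a g : v a = fin g -> v a^-1 = fin (- g).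
Proof.
move=> E; have a0 : a != 0 by apply/eqP => /(valuation_infty v); rewrite E.
have /valuation_fin[h H] : a^-1 != 0 by rewrite invr_eq0.
have := valuationM v a a^-1; rewrite mulfV// valuation1 E H => -[] /esym/eqP.
by rewrite addrC addr_eq0 => /eqP ->.
Qed.

End ValuationTheory.

Definition extends (F L : fieldType) (G : orderedGroupType) (j : F -> L)
    (v : valuation F G) (w : valuation L G) : Prop :=
  forall a, w (j a) = v a.

(* All valuations take their values in one ordered group [G], so a value group
   is a subgroup of [G]. *)
Section ValueGroup.
Variables (F : fieldType) (G : orderedGroupType) (v : valuation F G).

Definition in_value_group : {pred G} := fun g => `[< exists a, v a = fin g >].

Fact in_value_group_zmod : zmod_closed in_value_group.
Proof.
split; first by apply/asboolP; exists 1; rewrite valuation1.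
move=> g h /asboolP[a A] /asboolP[b B]; apply/asboolP; exists (a / b).
by rewrite valuationM A (valuationV B).
Qed.

HB.instance Definition _ :=
  GRing.isZmodClosed.Build G in_value_group in_value_group_zmod.

Definition value_group : Type := {g : G | g \in in_value_group}.

HB.instance Definition _ := SubChoice.on value_group.
HB.instance Definition _ :=
  GRing.SubChoice_isSubZmodule.Build G in_value_group value_group in_value_group_zmod.

End ValueGroup.

Section ValueQuotient.
Variables (F L : fieldType) (G : orderedGroupType).
Variables (v : valuation F G) (w : valuation L G).

Definition base_value : {pred value_group w} := fun g => val g \in in_value_group v.

Fact base_value_zmod : zmod_closed base_value.
Proof.
have E g : (g \in base_value) = (val g \in in_value_group v) by [].
split; first by rewrite E raddf0 rpred0.
by move=> g h; rewrite !E raddfB; apply: rpredB.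
Qed.

HB.instance Definition _ :=
  GRing.isZmodClosed.Build (value_group w) base_value base_value_zmod.

Definition value_quotient : zmodType := Quotient.quot base_value.

End ValueQuotient.

(* [tenq M] is a model of the tensor product of [M] and [rat] over the integers:
   the pair [(m, d)] stands for m (x) 1/(d+1), and [tensor m q] for m (x) q.  See
   [tensor_universal] for the universal property. *)
Section TensorQ.
Variable M : zmodType.
Implicit Types x y z : M * nat.

Definition tenq_eqv x y : bool :=
  `[< exists k, x.1 *+ (y.2.+1 * k.+1)%N = y.1 *+ (x.2.+1 * k.+1)%N >].

Fact tenq_eqv_refl : reflexive tenq_eqv.
Proof. by move=> x; apply/asboolP; exists 0. Qed.

Fact tenq_eqv_sym : symmetric tenq_eqv.
Proof. by move=> x y; apply/asboolP/asboolP => -[k E]; exists k. Qed.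

Fact tenq_eqv_trans : transitive tenq_eqv.
Proof.
move=> [m b] [l a] [n c] /asboolP[/= k E] /asboolP[/= h F].
apply/asboolP; exists (b.+1 * k.+1 * h.+1).-1%N ; rewrite prednK//; cbn [fst snd].
have -> : (c.+1 * (b.+1 * k.+1 * h.+1) = b.+1 * k.+1 * (c.+1 * h.+1))%N by nia.
have -> : (a.+1 * (b.+1 * k.+1 * h.+1) = b.+1 * h.+1 * (a.+1 * k.+1))%N by nia.
by rewrite mulrnA E -mulrnA mulnC mulrnA F -!mulrnA; congr (_ *+ _); nia.
Qed.

Canonical tenq_equiv := EquivRel tenq_eqv tenq_eqv_refl tenq_eqv_sym tenq_eqv_trans.

Definition tenq := {eq_quot tenq_eqv}.
HB.instance Definition _ : EqQuotient _ tenq_eqv tenq := EqQuotient.on tenq.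
HB.instance Definition _ := Choice.on tenq.

Definition tenq_frac (m : M) (d : nat) : tenq := \pi_tenq (m, d).

Lemma tenq_fracP m a n b :
  tenq_frac m a = tenq_frac n b <->
  exists k, m *+ (b.+1 * k.+1)%N = n *+ (a.+1 * k.+1)%N.
Proof. by split=> [/eqmodP/asboolP//|h]; apply/eqmodP/asboolP. Qed.

Lemma tenq_fracE m a n b : m *+ b.+1 = n *+ a.+1 -> tenq_frac m a = tenq_frac n b.
Proof. by move=> E; apply/tenq_fracP; exists 0; rewrite !muln1. Qed.

Lemma tenqW (P : tenq -> Prop) : (forall m a, P (tenq_frac m a)) -> forall t, P t.
Proof. by move=> h; elim/quotW => -[m a]; apply: h. Qed.

Definition tenq_add (s t : tenq) : tenq :=
  let: (m, a) := repr s in let: (n, b) := repr t in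
  tenq_frac (m *+ b.+1 + n *+ a.+1) (a.+1 * b.+1).-1%N.

Definition tenq_opp (s : tenq) : tenq := let: (m, a) := repr s in tenq_frac (- m) a.

Definition tenq_scale (q : rat) (s : tenq) : tenq :=
  let: (m, a) := repr s in tenq_frac (m *~ numq q) (a.+1 * `|denq q|).-1%N.

Lemma repr_frac m a : exists m' a', repr (tenq_frac m a) = (m', a') /\
  exists k, m' *+ (a.+1 * k.+1)%N = m *+ (a'.+1 * k.+1)%N.
Proof.
case E : (repr (tenq_frac m a)) => [m' a']; exists m', a'; split=> //.
by apply/tenq_fracP; rewrite /tenq_frac -E reprK.
Qed.

Lemma tenq_addE m a n b : tenq_add (tenq_frac m a) (tenq_frac n b) =
  tenq_frac (m *+ b.+1 + n *+ a.+1) (a.+1 * b.+1).-1%N.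
Proof.
rewrite /tenq_add; have [m' [a' [-> [k E]]]] := repr_frac m a.
have [n' [b' [-> [h F]]]] := repr_frac n b.
apply/tenq_fracP; exists (k.+1 * h.+1).-1%N; rewrite !prednK//.
rewrite !mulrnDl -!mulrnA.
have -> : (b'.+1 * (a.+1 * b.+1 * (k.+1 * h.+1)) = a.+1 * k.+1 * (b'.+1 * b.+1 * h.+1))%N by nia.
have -> : (a'.+1 * (a.+1 * b.+1 * (k.+1 * h.+1)) = b.+1 * h.+1 * (a'.+1 * a.+1 * k.+1))%N by nia.
rewrite mulrnA E [n' *+ _]mulrnA F -!mulrnA.
by congr (_ *+ _ + _ *+ _); nia.
Qed.

Lemma tenq_oppE m a : tenq_opp (tenq_frac m a) = tenq_frac (- m) a.
Proof.
rewrite /tenq_opp; have [m' [a' [-> [k E]]]] := repr_frac m a.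
by apply/tenq_fracP; exists k; rewrite !mulNrn E.
Qed.

Lemma tenq_scaleE q m a : tenq_scale q (tenq_frac m a) =
  tenq_frac (m *~ numq q) (a.+1 * `|denq q|).-1%N.
Proof.
rewrite /tenq_scale; have [m' [a' [-> [k E]]]] := repr_frac m a.
have d0 : (0 < `|denq q|)%N by rewrite absz_gt0 denq_neq0.
apply/tenq_fracP; exists k; rewrite !prednK ?muln_gt0//.
have -> : (a.+1 * `|denq q| * k.+1 = a.+1 * k.+1 * `|denq q|)%N by nia.
have -> : (a'.+1 * `|denq q| * k.+1 = a'.+1 * k.+1 * `|denq q|)%N by nia.
by rewrite !pmulrn -!mulrzA ![numq q * _]mulrC !mulrzA -!pmulrn !mulrnA -(mulrnA _ a.+1) E mulrnA.
Qed.

Fact tenq_addA : associative tenq_add.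
Proof.
elim/tenqW=> m a; elim/tenqW=> n b; elim/tenqW=> p c; rewrite !tenq_addE.
apply: tenq_fracE; rewrite !prednK// !mulrnDl -!mulrnA addrA.
by congr (_ *+ _ + _ *+ _ + _ *+ _); nia.
Qed.

Fact tenq_addC : commutative tenq_add.
Proof.
elim/tenqW=> m a; elim/tenqW=> n b; rewrite !tenq_addE addrC.
by rewrite [(b.+1 * _)%N]mulnC.
Qed.

Fact tenq_add0 : left_id (tenq_frac 0 0%N) tenq_add.
Proof.
elim/tenqW=> m a; rewrite !tenq_addE mul0rn add0r mulr1n.
by apply: tenq_fracE; rewrite prednK// mul1n.
Qed.

Fact tenq_addN : left_inverse (tenq_frac 0 0%N) tenq_opp tenq_add.
Proof.
elim/tenqW=> m a; rewrite tenq_oppE tenq_addE mulNrn addNr.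
by apply: tenq_fracE; rewrite !mul0rn.
Qed.

HB.instance Definition _ :=
  GRing.isZmodule.Build tenq tenq_addA tenq_addC tenq_add0 tenq_addN.

Lemma tenq_fracD m a n b : tenq_frac m a + tenq_frac n b =
  tenq_frac (m *+ b.+1 + n *+ a.+1) (a.+1 * b.+1).-1%N.
Proof. exact: tenq_addE. Qed.

Let denq_absz q : `|denq q|%N%:Z = denq q.
Proof. by rewrite absz_denq. Qed.

Fact tenq_scaleA q r s : tenq_scale q (tenq_scale r s) = tenq_scale (q * r) s.
Proof.
elim/tenqW: s => m a; rewrite !tenq_scaleE.
have dq (x : rat) : (0 < `|denq x|)%N by rewrite absz_gt0 denq_neq0.
apply: tenq_fracE; rewrite !prednK ?muln_gt0 ?dq//.
rewrite -!mulrzA !pmulrn -!mulrzA; congr (_ *~ _).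
rewrite !PoszM !denq_absz.
have qE (x : rat) : (numq x)%:~R = x * (denq x)%:~R by rewrite -numqE.
have : ((numq r * numq q * denq (q * r))%:~R == (numq (q * r) * denq r * denq q)%:~R :> rat).
  by rewrite !intrM !qE; apply/eqP; ring.
rewrite eqr_int => /eqP E.
by transitivity (a.+1%:Z * (numq r * numq q * denq (q * r))); [ring | rewrite E; ring].
Qed.

Fact tenq_scale1 : left_id 1 tenq_scale.
Proof.
by elim/tenqW=> m a; rewrite tenq_scaleE; apply: tenq_fracE; rewrite prednK// muln1.
Qed.

Fact tenq_scaleDr : right_distributive tenq_scale +%R.
Proof.
move=> q; elim/tenqW=> m a; elim/tenqW=> n b.
rewrite tenq_fracD !tenq_scaleE tenq_fracD.
have d0 : (0 < `|denq q|)%N by rewrite absz_gt0 denq_neq0.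
apply: tenq_fracE; rewrite !prednK ?muln_gt0 ?d0//.
rewrite mulrzDl !mulrnDl !pmulrn -!mulrzA.
by congr (_ *~ _ + _ *~ _); rewrite !PoszM; ring.
Qed.

Fact tenq_scaleDl s : {morph tenq_scale^~ s : q r / q + r}.
Proof.
move=> q r; elim/tenqW: s => m a; rewrite !tenq_scaleE tenq_fracD.
have dq (x : rat) : (0 < `|denq x|)%N by rewrite absz_gt0 denq_neq0.
apply: tenq_fracE; rewrite !prednK ?muln_gt0 ?dq//.
rewrite mulrnDl !pmulrn -!mulrzA -mulrzDr; congr (_ *~ _).
rewrite !PoszM !denq_absz.
have qE (x : rat) : (numq x)%:~R = x * (denq x)%:~R by rewrite -numqE.
have : ((numq (q + r) * (denq q * denq r))%:~R ==
  ((numq q * denq r + numq r * denq q) * denq (q + r))%:~R :> rat).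
  by rewrite !(intrM, intrD) !qE; apply/eqP; ring.
rewrite eqr_int => /eqP E.
transitivity (a.+1%:Z * a.+1%:Z * (numq (q + r) * (denq q * denq r))); first by ring.
by rewrite E; ring.
Qed.

HB.instance Definition _ := GRing.Zmodule_isLmodule.Build rat tenq
  tenq_scaleA tenq_scale1 tenq_scaleDr tenq_scaleDl.

Definition tensor (m : M) (q : rat) : tenq := q *: tenq_frac m 0%N.

Lemma tenq_fracDl m n a : tenq_frac (m + n) a = tenq_frac m a + tenq_frac n a.
Proof.
rewrite tenq_fracD; apply: tenq_fracE.
by rewrite prednK// -mulrnDl -mulrnA.
Qed.

Lemma tensorDl m n q : tensor (m + n) q = tensor m q + tensor n q.
Proof. by rewrite /tensor tenq_fracDl scalerDr. Qed.

Lemma tensorDr m q r : tensor m (q + r) = tensor m q + tensor m r.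
Proof. exact: scalerDl. Qed.

Lemma tenq_fracZ m a : tenq_frac m a = tensor m a.+1%:Q^-1.
Proof.
rewrite /tensor /GRing.scale/= tenq_scaleE.
have d0 : (0 < `|denq a.+1%:Q^-1|)%N by rewrite absz_gt0 denq_neq0.
apply: tenq_fracE; rewrite prednK ?muln_gt0 ?d0// mul1n !pmulrn -mulrzA.
congr (_ *~ _); rewrite absz_denq; apply/eqP.
rewrite -(@eqr_int rat) intrM numqE mulrAC mulVf ?mul1r//.
by rewrite intr_eq0.
Qed.

Lemma tensor1_eq0 m : tensor m 1 = 0 <-> exists k, m *+ k.+1 = 0.
Proof.
rewrite /tensor scale1r; split=> [/tenq_fracP[k]|[k E]].
  by rewrite mul0rn mul1n; exists k.
by apply/tenq_fracP; exists k; rewrite mul0rn mul1n.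
Qed.

Lemma tensor_universal (W : zmodType) (b : M -> rat -> W) :
  (forall m n q, b (m + n) q = b m q + b n q) ->
  (forall m q r, b m (q + r) = b m q + b m r) ->
  exists2 h : {additive tenq -> W}, (forall m q, h (tensor m q) = b m q) &
    forall g : {additive tenq -> W}, (forall m q, g (tensor m q) = b m q) -> g =1 h.
Proof.
move=> bDl bDr.
have b0l q : b 0 q = 0 by apply: (addrI (b 0 q)); rewrite -bDl !addr0.
have b0r m : b m 0 = 0 by apply: (addrI (b m 0)); rewrite -bDr !addr0.
have bMl m q k : b (m *+ k) q = b m q *+ k.
  by elim: k => [|k IH]; rewrite ?mulr0n// !mulrS bDl IH.
have bMr m q k : b m (q *+ k) = b m q *+ k.
  by elim: k => [|k IH]; rewrite ?mulr0n// !mulrS bDr IH.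
have bNl m q : b (- m) q = - b m q by apply/eqP; rewrite -addr_eq0 -bDl addNr b0l.
have bNr m q : b m (- q) = - b m q by apply/eqP; rewrite -addr_eq0 -bDr addNr b0r.
have bM m q k : b (m *+ k) q = b m (q *+ k) by rewrite bMl bMr.
pose h (t : tenq) := b (repr t).1 ((repr t).2.+1)%:Q^-1.
have hE m a : h (tenq_frac m a) = b m a.+1%:Q^-1.
  rewrite /h; have [m' [a' [-> [k E]]]] /= := repr_frac m a.
  pose N := (a.+1 * a'.+1 * k.+1)%N.
  have N0 : N%:Q != 0 by rewrite intr_eq0.
  have inv (x y : nat) : (x * y)%N = N -> (0 < x)%N -> x%:Q^-1 = N%:Q^-1 *+ y.
    move=> E' x0; apply: (mulfI N0); rewrite mulrnAr mulfV// -E' PoszM intrM.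
    by rewrite mulrAC mulfV ?mul1r ?pmulrn// intr_eq0 eqz_nat -lt0n.
  rewrite (inv a'.+1 (a.+1 * k.+1)%N) ?(inv a.+1 (a'.+1 * k.+1)%N) /N; try nia.
  by rewrite -!bM E.
have hD : nmod_morphism h.
  have h0 : h 0 = 0 by rewrite /GRing.zero/= hE b0l.
  split=> //; elim/tenqW=> m a; elim/tenqW=> n c.
  rewrite tenq_fracD !hE prednK// bDl !bM; congr (b _ _ + b _ _).
    rewrite PoszM intrM invfM -mulr_natr -mulrA [X in _ * X]mulVf ?mulr1//.
    by rewrite intr_eq0.
  rewrite PoszM intrM invfM -mulr_natr mulrAC mulVf ?mul1r//.
  by rewrite intr_eq0.
pose hM := GRing.isNmodMorphism.Build _ _ h hD.
pose H : {additive tenq -> W} := HB.pack h hM.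
exists H => [m q|g gE].
  rewrite /= /tensor /GRing.scale/= tenq_scaleE hE mul1n prednK; last first.
    by rewrite absz_gt0 denq_neq0.
  rewrite absz_denq.
  have bMz n (x : rat) : b (m *~ n) x = b m (x *~ n).
    case: n => n; rewrite ?NegzE ?mulrNz -!pmulrn ?bNl ?bNr bM//.
  by rewrite bMz -mulrzl numqE mulfK// intr_eq0.
by elim/tenqW=> m a; rewrite /= hE tenq_fracZ gE.
Qed.
End TensorQ.

Definition has_dim (F : fieldType) (V : lmodType F) (n : nat) : Prop :=
  exists e : 'I_n -> V,
    (forall c : 'I_n -> F, \sum_i c i *: e i = 0 -> forall i, c i = 0) /\
    (forall u, exists c : 'I_n -> F, u = \sum_i c i *: e i).

Definition value_transcendental (F L : fieldType) (G : orderedGroupType)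
    (v : valuation F G) (w : valuation L G) : Prop :=
  has_dim (tenq (value_quotient v w)) 1%N.

Section ResidueField.
Variables (F : fieldType) (G : orderedGroupType) (v : valuation F G).

Definition in_valuation_ring : {pred F} := fun a => (0 : withtop G) <= v a.

Fact in_valuation_ring_subring : subring_closed in_valuation_ring.
Proof.
split=> [|a b|a b]; rewrite !unfold_in /in_valuation_ring.
- by rewrite valuation1.
- move=> a0 b0; apply: le_trans (valuationD v a (- b)).
  by rewrite le_min a0 valuationN.
- move=> a0 b0; rewrite valuationM; apply: le_trans a0 _.
  by rewrite -[X in X <= _]addr0 leD2l_withtop.
Qed.

HB.instance Definition _ :=
  GRing.isSubringClosed.Build F in_valuation_ring in_valuation_ring_subring.

Definition valuation_ring : Type := {a : F | a \in in_valuation_ring}.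

HB.instance Definition _ := SubChoice.on valuation_ring.
HB.instance Definition _ := GRing.SubChoice_isSubComNzRing.Build
  F in_valuation_ring valuation_ring in_valuation_ring_subring.

Definition maximal_ideal : {pred valuation_ring} := fun a => (0 : withtop G) < v (val a).

Fact maximal_idealr_closed : idealr_closed maximal_ideal.
Proof.
split=> [||a b c]; rewrite !unfold_in /maximal_ideal.
- by rewrite raddf0 valuation0.
- by rewrite rmorph1 valuation1 ltxx.
- move=> b0 c0; rewrite rmorphD rmorphM/=.
  apply: lt_le_trans (valuationD v _ _); rewrite lt_min c0 andbT valuationM.
  apply: lt_le_trans b0 _; rewrite addrC -[X in X <= _]addr0 leD2l_withtop//.
  exact: (valP a).
Qed.

HB.instance Definition _ :=
  isIdealr.Build valuation_ring maximal_ideal maximal_idealr_closed.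

Definition residue_field : Type := {ideal_quot maximal_ideal}.

HB.instance Definition _ := GRing.ComNzRing.on residue_field.
HB.instance Definition _ := EqQuotient.on residue_field.

Definition residue (a : valuation_ring) : residue_field := \pi_residue_field a.

Fact residue_zmod_morphism : zmod_morphism residue.
Proof. exact: (raddfB \pi_({ideal_quot maximal_ideal})). Qed.

Fact residue_monoid_morphism : monoid_morphism residue.
Proof. split; first exact: (rmorph1 \pi_({ideal_quot maximal_ideal})).
exact: (rmorphM \pi_({ideal_quot maximal_ideal})). Qed.

HB.instance Definition _ := GRing.isZmodMorphism.Build
  valuation_ring residue_field residue residue_zmod_morphism.
HB.instance Definition _ := GRing.isMonoidMorphism.Build
  valuation_ring residue_field residue residue_monoid_morphism.

Lemma residue_eq0 a : (residue a == 0) = ((0 : withtop G) < v (val a)).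
Proof.
rewrite -(rmorph0 residue); have := Quotient.idealrBE maximal_ideal a 0.
by rewrite subr0 => <-.
Qed.

Definition residue_inv (t : residue_field) : residue_field :=
  if t == 0 then 0 else residue (insubd 0 (val (repr t))^-1).

Fact residue_mulV t : t != 0 -> residue_inv t * t = 1.
Proof.
move=> t0; rewrite /residue_inv (negPf t0).
have rE : residue (repr t) = t := reprK t.
have v0 : v (val (repr t)) = 0.
  have vge0 : (0 : withtop G) <= v (val (repr t)) := valP (repr t).
  apply: le_anti; rewrite vge0 andbT leNgt.
  by rewrite -residue_eq0 rE.
have inv0 : (val (repr t))^-1 \in in_valuation_ring.
  by rewrite unfold_in /in_valuation_ring (valuationV v0) oppr0.
rewrite -[X in _ * X]rE -rmorphM -(rmorph1 residue); congr (residue _).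
apply: val_inj; rewrite rmorphM rmorph1 /= insubdK// mulVf//.
by apply/eqP => /(valuation_infty v); rewrite v0.
Qed.

Fact residue_inv0 : residue_inv 0 = 0.
Proof. by rewrite /residue_inv eqxx. Qed.

HB.instance Definition _ :=
  GRing.ComNzRing_isField.Build residue_field residue_mulV residue_inv0.

End ResidueField.

(* The map induced by [j] on residue fields, when [w] extends [v] along [j]. *)
Definition residue_map (F L : fieldType) (G : orderedGroupType) (j : F -> L)
    (v : valuation F G) (w : valuation L G) (t : residue_field v) : residue_field w :=
  residue (insubd 0 (j (val (repr t)))).
Arguments residue_map {F L G} j v w t.

Section AlgebraicIndependence.
Import mpoly.

(* [mmap j t P] is the value at [t] of the image of [P] under [j]. *)
Definition algebraically_independent (k E : fieldType) (j : k -> E) (n : nat)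
    (t : 'I_n -> E) : Prop :=
  forall P : {mpoly k[n]}, mmap j t P = 0 -> P = 0.

End AlgebraicIndependence.

Definition has_trdeg (k E : fieldType) (j : k -> E) (n : nat) : Prop :=
  (exists t : 'I_n -> E, algebraically_independent j t) /\
  (forall t : 'I_n.+1 -> E, ~ algebraically_independent j t).

Definition residue_transcendental (F L : fieldType) (G : orderedGroupType)
    (j : F -> L) (v : valuation F G) (w : valuation L G) : Prop :=
  has_trdeg (residue_map j v w) 1%N.

Definition valuation_transcendental (F L : fieldType) (G : orderedGroupType)
    (j : F -> L) (v : valuation F G) (w : valuation L G) : Prop :=
  value_transcendental v w \/ residue_transcendental j v w.

Notation ratfun F := {fraction {poly F}}.
Notation "p %:F" := (@FracField.tofrac _ p) : ring_scope.

Definition ratfun_const (F : fieldType) (c : F) : ratfun F := (c%:P)%:F.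

Section RatfunMap.
Variables (F L : fieldType) (j : {rmorphism F -> L}).

Lemma frac_repr (R : idomainType) (x : {fraction R}) :
  x = (\n_(repr x))%:F / (\d_(repr x))%:F.
Proof.
rewrite -{1}[x]reprK; set r := repr x.
have -> : (\n_r)%:F = \pi_({fraction R}) (Ratio \n_r 1) by unlock FracField.tofrac.
have -> : (\d_r)%:F = \pi_({fraction R}) (Ratio \d_r 1) by unlock FracField.tofrac.
rewrite -[X in _ = _ * X]FracField.pi_inv -[RHS]FracField.pi_mul.
apply/eqmodP; rewrite /= FracField.equivfE /FracField.mulf /FracField.invf.
by rewrite !numden_Ratio ?mulr1 ?mul1r ?oner_eq0 ?denom_ratioP// mulrC.
Qed.

Definition ratfun_map (x : ratfun F) : ratfun L :=
  (map_poly j \n_(repr x))%:F / (map_poly j \d_(repr x))%:F.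

Lemma ratfun_mapE p q : q != 0 ->
  ratfun_map (p%:F / q%:F) = (map_poly j p)%:F / (map_poly j q)%:F.
Proof.
move=> q0; have d0 := denom_ratioP (repr (p%:F / q%:F)).
have := frac_repr (p%:F / q%:F); rewrite /ratfun_map.
move: (\n_(repr _)) (\d_(repr _)) d0 => n d d0.
move/eqP; rewrite eqr_div ?tofrac_eq0// -!tofracM tofrac_eq => /eqP E.
by apply/eqP; rewrite eqr_div ?tofrac_eq0 ?map_poly_eq0// -!tofracM -!rmorphM E.
Qed.

Fact ratfun_map_zmod_morphism : zmod_morphism ratfun_map.
Proof.
move=> x y; have x0 := denom_ratioP (repr x); have y0 := denom_ratioP (repr y).
rewrite [x]frac_repr [y]frac_repr; move: (\n_(repr x)) (\n_(repr y)) => n m.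
move: (\d_(repr x)) (\d_(repr y)) x0 y0 => d e d0 e0.
rewrite -mulNr addf_div ?tofrac_eq0// -tofracN -!tofracM -tofracD.
rewrite !ratfun_mapE ?mulf_neq0// rmorphD !rmorphM rmorphN/=.
rewrite -[in RHS]mulNr addf_div ?tofrac_eq0 ?map_poly_eq0//.
by rewrite -tofracN -!tofracM -tofracD.
Qed.

Fact ratfun_map_monoid_morphism : monoid_morphism ratfun_map.
Proof.
split=> [|x y].
  rewrite -[1]divr1 -tofrac1 ratfun_mapE ?oner_eq0// rmorph1 tofrac1.
  by rewrite divr1.
have x0 := denom_ratioP (repr x); have y0 := denom_ratioP (repr y).
rewrite [x]frac_repr [y]frac_repr; move: (\n_(repr x)) (\n_(repr y)) => n m.
move: (\d_(repr x)) (\d_(repr y)) x0 y0 => d e d0 e0.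
rewrite mulf_div -!tofracM !ratfun_mapE ?mulf_neq0//.
by rewrite mulf_div !rmorphM.
Qed.

HB.instance Definition _ := GRing.isZmodMorphism.Build
  (ratfun F) (ratfun L) ratfun_map ratfun_map_zmod_morphism.
HB.instance Definition _ := GRing.isMonoidMorphism.Build
  (ratfun F) (ratfun L) ratfun_map ratfun_map_monoid_morphism.

End RatfunMap.

Section AlgebraicClosure.
Variables (K Kbar : fieldType) (iota : {rmorphism K -> Kbar}).

(* u lies in K(a), the smallest subfield containing the image of K and a. *)
Definition adjoin (a u : Kbar) : Prop :=
  forall S : {pred Kbar}, divring_closed S -> (forall c, iota c \in S) ->
    a \in S -> u \in S.

(* [K(a) : K] = n: the family e is a K-basis of K(a). *)
Definition ext_degree (a : Kbar) (n : nat) : Prop :=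
  exists e : 'I_n -> Kbar,
    (forall c : 'I_n -> K, \sum_i iota (c i) * e i = 0 -> forall i, c i = 0) /\
    (forall u, adjoin a u <-> exists c : 'I_n -> K, u = \sum_i iota (c i) * e i).

Variable G : orderedGroupType.

(* [w] is the valuation of K(x) with
   w (sum_i c_i (x - a)^i) = min_i (v c_i + i gamma). *)
Definition is_monomial_valuation (v : valuation Kbar G) (a : Kbar) (gamma : G)
    (w : valuation (ratfun Kbar) G) : Prop :=
  forall n (c : 'I_n -> Kbar),
    w (\sum_i (c i)%:P * ('X - a%:P) ^+ i)%:F =
    \big[Num.min/infty]_i (v (c i) + fin (gamma *+ i)).

Variables (nubar : valuation Kbar G) (omegabar : valuation (ratfun Kbar) G).

Definition pair_of_definition (a : Kbar) (gamma : G) : Prop :=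
  gamma \in in_value_group omegabar /\
  is_monomial_valuation nubar a gamma omegabar.

Definition minimal_pair_of_definition (a : Kbar) (gamma : G) : Prop :=
  pair_of_definition a gamma /\
  forall b, fin gamma <= nubar (a - b) ->
    forall m n, ext_degree a m -> ext_degree b n -> (m <= n)%N.

(* d is the maximum of omegabar (x - c) over the roots c of f in Kbar. *)
Definition is_delta (f : {poly K}) (d : withtop G) : Prop :=
  (exists2 c, root (map_poly iota f) c & omegabar ('X - c%:P)%:F = d) /\
  (forall c, root (map_poly iota f) c -> omegabar ('X - c%:P)%:F <= d).

Definition maximal_root (f : {poly K}) (c : Kbar) : Prop :=
  root (map_poly iota f) c /\ is_delta f (omegabar ('X - c%:P)%:F).

Definition key_polynomial (Q : {poly K}) : Prop :=
  [/\ Q \is monic, (1 < size Q)%N &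
    forall f : {poly K}, (1 < size f < size Q)%N ->
      forall d e, is_delta f d -> is_delta Q e -> d < e].

End AlgebraicClosure.

(* The index set of a sequence of limit ordinal length: a nonempty well-order
   with no greatest element. *)
Definition limit_well_order d (I : orderType d) : Prop :=
  [/\ exists i : I, True, well_founded (fun i j : I => (i < j)%O) &
    forall i : I, exists j, (i < j)%O].

Definition is_successor d (I : orderType d) (i j : I) : Prop :=
  (i < j)%O /\ forall k, (i < k)%O -> (j <= k)%O.

Section PseudoCauchy.
Variables (K : fieldType) (G : orderedGroupType) (nu : valuation K G).
Variables (d : Order.disp_t) (I : orderType d) (z : I -> K).

Definition pseudo_cauchy : Prop :=
  forall i j k, (i < j)%O -> (j < k)%O -> nu (z i - z j) < nu (z j - z k).

Definition is_limit (L : fieldType) (j : K -> L) (w : valuation L G) (l : L) : Prop :=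
  forall i i', is_successor i i' -> w (l - j (z i)) = nu (z i - z i').

Definition ultimately_constant (f : {poly K}) : Prop :=
  exists i0, forall i, (i0 <= i)%O -> nu f.[z i] = nu f.[z i0].

Definition ultimately_increasing (f : {poly K}) : Prop :=
  exists i0, forall i j, (i0 <= i)%O -> (i < j)%O -> nu f.[z i] < nu f.[z j].

Definition transcendental_type : Prop := forall f, ultimately_constant f.

Definition algebraic_type : Prop := ~ transcendental_type.

Definition associated_minimal_polynomial (m : {poly K}) : Prop :=
  [/\ algebraic_type, m \is monic, ultimately_increasing m &
    forall f : {poly K}, f \is monic -> ultimately_increasing f ->
      (size m <= size f)%N].

End PseudoCauchy.

(* Main.v *)
Require Import Defs.
From HB Require Import structures.
From mathcomp Require Import all_boot all_order all_algebra.
From mathcomp.classical Require Import boolp.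
From mathcomp.multinomials Require mpoly.

Set Implicit Arguments.
Unset Strict Implicit.
Unset Printing Implicit Defensive.

Import Order.TTheory GRing.Theory Num.Theory.

Local Open Scope ring_scope.
Local Open Scope quotient_scope.

(**
A pseudo-limit of [(z_i)] in an extension of [K] is compared with the roots of
polynomials: if [x] is a pseudo-limit and [c] is not, then [x - c] has the value
of [z_i - c] for large [i], which is smaller than [v (z_i - z_j)]; if both are
pseudo-limits, [v (x - c)] exceeds all [v (z_i - z_j)].  So over the algebraic
closure a polynomial is ultimately increasing along the sequence iff one of its
roots is a pseudo-limit, and (iv) follows by comparing roots; (ii), (iii) and the
converse read off the values [min (v (a - c), gamma)] of [x - c] or the
definition of a key polynomial.  If no element of the algebraic closure were a
pseudo-limit, [h(x) / h(z_i)] would be a 1-unit for every nonzero rational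
function [h] and large [i], so [K(x)] would be an immediate extension of [K],
which is not valuation transcendental.
*)

(** * Order and addition in an ordered group with infinity *)

Section WithTopOrder.
Variable G : orderedGroupType.
Implicit Types (a b c e : withtop G) (g : G).

Lemma lt_infty a b : a < b -> a != infty.
Proof. by case: a b => [g|] [h|]. Qed.

Lemma leD_withtop a b c e : a <= b -> c <= e -> a + c <= b + e.
Proof.
move=> ab ce; apply: le_trans (leD2l_withtop b ce).
by rewrite addrC [b + c]addrC leD2l_withtop.
Qed.

Lemma addI_fin g a b : fin g + a = fin g + b -> a = b.
Proof. by case: a b => [a|] [b|] // [] /addrI ->. Qed.

Lemma ltD_withtop a b c e : c != infty -> a < b -> c <= e -> a + c < b + e.
Proof.
case: c => [g|//] _ ab ge; apply: lt_le_trans (leD2l_withtop b ge).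
rewrite addrC [b + _]addrC lt_neqAle leD2l_withtop ?(ltW ab)// andbT.
by apply: contra_neq (negbT (lt_eqF ab)) => /addI_fin.
Qed.

End WithTopOrder.

(** * The ultrametric inequality and 1-units *)

Section Ultrametric.
Variables (L : fieldType) (G : orderedGroupType) (v : valuation L G).
Implicit Types a b : L.

Lemma valuation_neq_infty a : (v a != infty) = (a != 0).
Proof. by congr (~~ _); apply/eqP/eqP => /(valuation_infty v). Qed.

Lemma valuationBC a b : v (a - b) = v (b - a).
Proof. by rewrite -valuationN opprB. Qed.

Lemma valuationB a b : Num.min (v a) (v b) <= v (a - b).
Proof. by have := valuationD v a (- b); rewrite valuationN. Qed.

(** For the upper bound, write [a = (a + b) - b], where [b] cannot attain the minimum. *)
Lemma valuationD_lt a b : v a < v b -> v (a + b) = v a.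
Proof.
move=> ab; apply: le_anti; apply/andP; split; last first.
  by have := valuationD v a b; rewrite min_l// ltW.
have := valuationB (a + b) b; rewrite addrK ge_min => /orP[//|].
by rewrite leNgt ab.
Qed.

Lemma valuationB_lt a b : v a < v b -> v (a - b) = v a.
Proof. by move=> ab; rewrite valuationD_lt ?valuationN. Qed.

Definition one_unit a : Prop := (0 : withtop G) < v (a - 1).

Lemma one_unit_val a : one_unit a -> v a = 0.
Proof.
move=> a1; rewrite -[a](addrNK 1) addrC -(valuation1 v); apply: valuationD_lt.
by rewrite valuation1.
Qed.

Lemma one_unit_neq0 a : one_unit a -> a != 0.
Proof. by move=> /one_unit_val a0; rewrite -valuation_neq_infty a0. Qed.

Lemma one_unit1 : one_unit 1.
Proof. by rewrite /one_unit subrr valuation0. Qed.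

Lemma one_unitM a b : one_unit a -> one_unit b -> one_unit (a * b).
Proof.
(* Splits [a * b - 1] as [a * (b - 1) + (a - 1)]; here [a] has value 0. *)
move=> a1 b1; rewrite /one_unit -[_ - 1](subrKA a) -{2}[a]mulr1 -mulrBr.
apply: lt_le_trans (valuationD v _ _).
by rewrite lt_min valuationM (one_unit_val a1) add0r b1.
Qed.

Lemma one_unitV a : one_unit a -> one_unit a^-1.
Proof.
move=> a1; rewrite /one_unit.
have -> : v (a^-1 - 1) = v (a * (a^-1 - 1)).
  by rewrite valuationM (one_unit_val a1) add0r.
by rewrite mulrBr mulfV ?one_unit_neq0// mulr1 valuationBC.
Qed.

Lemma one_unit_valE a b : b != 0 -> one_unit (a / b) -> v a = v b.
Proof.
move=> b0 ab; have -> : a = a / b * b by rewrite divfK.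
by rewrite valuationM (one_unit_val ab) add0r.
Qed.

(** Since [a - b = b * (a / b - 1)], the finite value of [b] can be cancelled. *)
Lemma one_unit_divP a b : b != 0 -> one_unit (a / b) <-> v b < v (a - b).
Proof.
move=> b0; have [g bg] := valuation_fin v b0.
have -> : a - b = b * (a / b - 1) by rewrite mulrBr mulr1 mulrC divfK.
rewrite /one_unit valuationM; split=> h.
  rewrite -[X in X < _]addr0 addrC [X in _ < X]addrC.
  by apply: ltD_withtop; rewrite ?bg.
rewrite ltNge; apply/negP => h0; move: h; rewrite ltNge => /negP; apply.
by rewrite -[X in _ <= X]addr0 leD2l_withtop.
Qed.

End Ultrametric.

(** * Limit ordinals as well-orders *)

Section LimitWellOrder.
Variables (d : Order.disp_t) (I : orderType d) (I_limit : limit_well_order I).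

Lemma limit_order_inhabited : exists i : I, True.
Proof. by case: I_limit. Qed.

Lemma limit_order_unbounded (i : I) : exists j, (i < j)%O.
Proof. by case: I_limit. Qed.

(** Without a successor, well-founded induction shows that nothing lies above [i]. *)
Lemma exists_successor (i : I) : exists j, is_successor i j.
Proof.
case: I_limit => _ wf nomax; apply: contrapT => nosucc.
have [j ij] := nomax i.
elim/(well_founded_ind wf): j => j IH in ij *.
apply: nosucc; exists j; split=> // k ik.
by case: (leP j k) => // kj; case: (IH k kj ik).
Qed.

End LimitWellOrder.

(** * Pseudo-limits and the values of split polynomials *)

Section PseudoLimits.
Variables (L : fieldType) (G : orderedGroupType) (v : valuation L G).
Variables (d : Order.disp_t) (I : orderType d) (I_limit : limit_well_order I).
Variables (y : I -> L) (y_pc : pseudo_cauchy v y).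
Implicit Types (i j k : I) (c l t : L) (rs : seq L).

(** For [j < k], [y i - y k] is [y i - y j] plus a term of larger value. So this value depends on
    [i] alone; call it the gap at [i]. *)
Lemma pc_gap i j k : (i < j)%O -> (i < k)%O -> v (y i - y j) = v (y i - y k).
Proof.
wlog jk : j k / (j < k)%O => [IH ij ik|ij _].
  by have [/IH->|/IH->|->] := ltgtP j k.
by rewrite -[y i - y k](subrKA (y j)) (valuationD_lt (y_pc ij jk)).
Qed.

Definition pseudo_limit l := forall i j, (i < j)%O -> v (l - y i) = v (y i - y j).

Lemma pseudo_limitP l :
  pseudo_limit l <->
  forall i i', is_successor i i' -> v (l - y i) = v (y i - y i').
Proof.
split=> [h i i' [ii' _]|h i j ij]; first exact: h.
have [i' ii'] := exists_successor I_limit i.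
by rewrite (h _ _ ii'); apply: pc_gap => //; case: ii'.
Qed.

(** If [c - y i] has a value below the gap at [i], it keeps that value at later indices while the
    gaps grow. If its value is above the gap at [i], then [c - y j] has that gap as its value, which
    is below the gap at [j]. *)
Lemma not_pseudo_limit c : ~ pseudo_limit c ->
  exists i0, forall i j, (i0 <= i)%O -> (i < j)%O -> v (c - y i) < v (y i - y j).
Proof.
have from_lt i j : (i < j)%O -> v (c - y i) < v (y i - y j) ->
    exists i0, forall i j, (i0 <= i)%O -> (i < j)%O -> v (c - y i) < v (y i - y j).
  move=> ij lt_ij; exists i => k l; rewrite le_eqVlt => /predU1P[<-|ik] kl.
    by rewrite (pc_gap kl ij).
  rewrite (pc_gap ij ik) in lt_ij; rewrite -[c - y k](subrKA (y i)).
  by rewrite (valuationD_lt lt_ij) (lt_trans lt_ij) ?y_pc.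
move=> nlim; apply: contrapT => none; apply: nlim => i j ij.
case: (ltgtP (v (c - y i)) (v (y i - y j))) => // h.
  by case: none; apply: from_lt ij h.
have [k jk] := limit_order_unbounded I_limit j.
case: none; apply: (from_lt j k jk).
by rewrite -[c - y j](subrKA (y i)) addrC (valuationD_lt h) y_pc.
Qed.

(** Both limits differ from [y j] by the gap at [j], which exceeds the gap at [i]. *)
Lemma lt_pseudo_limits l c i j : pseudo_limit l -> pseudo_limit c ->
  (i < j)%O -> v (y i - y j) < v (l - c).
Proof.
move=> ll cl ij; have [k jk] := limit_order_unbounded I_limit j.
apply: lt_le_trans (y_pc ij jk) _.
have -> : l - c = (l - y j) - (c - y j) by rewrite opprB subrKA.
by apply: le_trans (valuationB v _ _); rewrite (ll _ _ jk) (cl _ _ jk) minxx.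
Qed.

(** In [(l - y i) - (c - y i)] the second term has the smaller value for late [i]. *)
Lemma lt_not_pseudo_limit l c : pseudo_limit l -> ~ pseudo_limit c ->
  exists i j, (i < j)%O /\ v (l - c) < v (y i - y j).
Proof.
move=> ll /not_pseudo_limit[i h]; have [j ij] := limit_order_unbounded I_limit i.
have ci := h i j (lexx i) ij; exists i, j; split=> //.
have -> : l - c = (l - y i) - (c - y i) by rewrite opprB subrKA.
by rewrite valuationBC valuationB_lt// (ll _ _ ij).
Qed.

(* [t] is at least as close to [y i] as the later terms of the sequence and
   their limits are. *)
Definition close_to i t := forall j, (i < j)%O -> v (y i - y j) <= v (t - y i).

Lemma close_to_limit i l : pseudo_limit l -> close_to i l.
Proof. by move=> ll j ij; rewrite (ll _ _ ij). Qed.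

Lemma close_to_later i j : (i <= j)%O -> close_to i (y j).
Proof.
rewrite le_eqVlt => /predU1P[<- k _|ij k ik].
  by rewrite subrr valuation0.
by rewrite [v (y j - _)]valuationBC (pc_gap ij ik).
Qed.

Definition root_prod rs t := \prod_(c <- rs) (t - c).

Lemma root_prod_cons c rs t : root_prod (c :: rs) t = (t - c) * root_prod rs t.
Proof. exact: big_cons. Qed.

(** The factors [t - c] and [y i - c] differ by [t - y i], whose value is at least the gap at [i],
    hence above the value of [y i - c] for late [i]. *)
Lemma root_prod_one_unit rs : (forall c, c \in rs -> ~ pseudo_limit c) ->
  exists i0, forall i, (i0 <= i)%O -> root_prod rs (y i) != 0 /\
    forall t, close_to i t -> one_unit v (root_prod rs t / root_prod rs (y i)).
Proof.
elim: rs => [_|c rs IH h].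
  have [i _] := limit_order_inhabited I_limit; exists i => j _.
  rewrite /root_prod !big_nil oner_eq0; split=> // t _.
  by rewrite big_nil divr1; apply: one_unit1.
have [|i1 h1] := IH; first by move=> e ers; apply: h; rewrite inE ers orbT.
have [i2 h2] := not_pseudo_limit (h c (mem_head _ _)).
exists (Order.max i1 i2) => i; rewrite ge_max => /andP[i1i i2i].
have [j ij] := limit_order_unbounded I_limit i.
have ci := h2 _ _ i2i ij; have [P0 P1] := h1 _ i1i.
have yc0 : y i - c != 0.
  by rewrite -(valuation_neq_infty v) valuationBC; apply: lt_infty ci.
rewrite root_prod_cons mulf_neq0//; split=> // t ti.
rewrite root_prod_cons -mulf_div; apply: one_unitM (P1 t ti).
apply/one_unit_divP => //; rewrite valuationBC.
have -> : t - c - (y i - c) = t - y i by rewrite opprB subrKA.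
by apply: lt_le_trans ci (ti _ ij).
Qed.

(** The later terms of the sequence are themselves close to [y i0]. *)
Lemma root_prod_constant rs : (forall c, c \in rs -> ~ pseudo_limit c) ->
  exists i0, forall i, (i0 <= i)%O -> v (root_prod rs (y i)) = v (root_prod rs (y i0)).
Proof.
move=> /root_prod_one_unit[i0 h]; exists i0 => i ii0.
have [P0 P1] := h _ (lexx i0).
exact: one_unit_valE P0 (P1 _ (close_to_later ii0)).
Qed.

(** Nonvanishing is recorded because a strict inequality survives the addition of finite values
    only. *)
Lemma root_prod_nondecreasing rs : exists i0, forall i j, (i0 <= i)%O -> (i < j)%O ->
  root_prod rs (y i) != 0 /\ v (root_prod rs (y i)) <= v (root_prod rs (y j)).
Proof.
elim: rs => [|c rs [i1 h1]].
  have [i _] := limit_order_inhabited I_limit; exists i => j k _ _.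
  by rewrite /root_prod !big_nil oner_eq0.
suff [i2 h2] : exists i0, forall i j, (i0 <= i)%O -> (i < j)%O ->
    y i - c != 0 /\ v (y i - c) <= v (y j - c).
  exists (Order.max i1 i2) => i j; rewrite ge_max => /andP[i1i i2i] ij.
  have [P0 P1] := h1 _ _ i1i ij; have [c0 c1] := h2 _ _ i2i ij.
  by rewrite !root_prod_cons !valuationM mulf_neq0//; split=> //; apply: leD_withtop.
(* The value of [y i - c] is the gap at [i] if [c] is a limit, and ultimately constant otherwise. *)
have [cl|ncl] := pselect (pseudo_limit c).
  have [i _] := limit_order_inhabited I_limit; exists i => j k _ jk.
  have [l kl] := limit_order_unbounded I_limit k.
  have lt_jk : v (y j - c) < v (y k - c).
    by rewrite ![v (_ - c)]valuationBC (cl _ _ jk) (cl _ _ kl) y_pc.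
  by rewrite ltW// -(valuation_neq_infty v) (lt_infty lt_jk).
have [|i0 h] := @root_prod_one_unit [:: c].
  by move=> e; rewrite inE => /eqP ->.
exists i0 => i j i0i ij; have [P0 P1] := h _ i0i.
have := one_unit_valE P0 (P1 _ (close_to_later (ltW ij))).
by rewrite /root_prod !big_seq1 in P0 * => ->.
Qed.

(** One occurrence of [c] is split off: its factor has the gaps as values, and the remaining product
    is ultimately nondecreasing. *)
Lemma root_prod_increasing rs c : c \in rs -> pseudo_limit c ->
  exists i0, forall i j, (i0 <= i)%O -> (i < j)%O ->
    v (root_prod rs (y i)) < v (root_prod rs (y j)).
Proof.
move=> crs cl; have [i0 h] := root_prod_nondecreasing (rem c rs).
exists i0 => i j i0i ij; have [P0 P1] := h _ _ i0i ij.
have [k jk] := limit_order_unbounded I_limit j.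
have remE t : root_prod rs t = root_prod (c :: rem c rs) t.
  by rewrite /root_prod; apply: perm_big; apply: perm_to_rem.
rewrite !remE !root_prod_cons !valuationM; apply: ltD_withtop => //.
  by rewrite valuation_neq_infty.
by rewrite ![v (_ - c)]valuationBC (cl _ _ ij) (cl _ _ jk) y_pc.
Qed.

End PseudoLimits.

(** * Immediate extensions and value groups *)

Section ImmediateExtension.
Variables (F L : fieldType) (G : orderedGroupType) (j : {rmorphism F -> L}).
Variables (v : valuation F G) (w : valuation L G) (jvw : extends j v w).

(* Equivalent to equality of the value groups and of the residue fields. *)
Definition immediate : Prop :=
  forall h : L, h != 0 -> exists2 k : F, k != 0 & one_unit w (h / j k).

Hypothesis w_imm : immediate.

Lemma immediate_value_group (g : value_group w) : val g \in in_value_group v.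
Proof.
have /asboolP[h hg] := valP g.
have h0 : h != 0 by rewrite -(valuation_neq_infty w) hg.
have [k k0 hk] := w_imm h0; apply/asboolP; exists k.
by rewrite -hg -jvw -(one_unit_valE _ hk)// fmorph_eq0.
Qed.

Lemma immediate_value_quotient (q : value_quotient v w) : q = 0.
Proof.
elim/quotW: q => g; apply/eqP.
rewrite -(raddf0 \pi_(Quotient.quot (@base_value _ _ _ v w))) -Quotient.idealrBE subr0.
exact: immediate_value_group.
Qed.

(** The value quotient vanishes, and with it its tensor product with the rationals, so that no basis
    vector can exist. *)
Lemma immediate_not_value_transcendental : ~ value_transcendental v w.
Proof.
case=> e [free _].
have e0 i : e i = 0.
  elim/tenqW: (e i) => m n; rewrite (immediate_value_quotient m).
  by apply: tenq_fracE; rewrite !mul0rn.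
have /free/(_ ord0)/eqP : \sum_i (1 : rat) *: e i = 0.
  by rewrite big1 // => i _; rewrite e0 scaler0.
by rewrite oner_eq0.
Qed.

End ImmediateExtension.

(** * Residue fields of extensions *)

Lemma residue_eqP (F : fieldType) (G : orderedGroupType) (v : valuation F G)
    (a b : valuation_ring v) :
  residue a = residue b <-> (0 : withtop G) < v (val a - val b).
Proof.
have -> : val a - val b = val (a - b) by rewrite raddfB.
rewrite -residue_eq0 raddfB subr_eq0.
exact: (rwP eqP).
Qed.

Section ResidueMap.
Variables (F L : fieldType) (G : orderedGroupType) (j : {rmorphism F -> L}).
Variables (v : valuation F G) (w : valuation L G) (jvw : extends j v w).
Import mpoly.
Implicit Types a b : valuation_ring v.

Lemma extends_valuation_ring a : j (val a) \in in_valuation_ring w.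
Proof. by rewrite unfold_in /in_valuation_ring jvw; apply: (valP a). Qed.

Definition ring_inclusion a : valuation_ring w :=
  Sub (j (val a)) (extends_valuation_ring a).

Lemma val_ring_inclusion a : val (ring_inclusion a) = j (val a).
Proof. by []. Qed.

(** [residue_map] uses a chosen representative; any other one differs from it by an element of
    positive value. *)
Lemma residue_map_residue a :
  residue_map j v w (residue a) = residue (ring_inclusion a).
Proof.
apply/residue_eqP; rewrite insubdK ?extends_valuation_ring//=.
by rewrite -rmorphB jvw; apply/residue_eqP; apply: reprK.
Qed.

Lemma residue_map_zmod_morphism : zmod_morphism (residue_map j v w).
Proof.
elim/quotW=> a; elim/quotW=> b; rewrite -!/(residue _) -raddfB.
rewrite !residue_map_residue -raddfB; congr residue; apply: val_inj.
by rewrite val_ring_inclusion !raddfB.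
Qed.

Lemma residue_map_monoid_morphism : monoid_morphism (residue_map j v w).
Proof.
split=> [|t u].
  rewrite -!(rmorph1 (@residue _ _ _)) residue_map_residue; congr residue.
  by apply: val_inj; rewrite val_ring_inclusion !rmorph1.
elim/quotW: t => a; elim/quotW: u => b; rewrite -!/(residue _) -rmorphM.
rewrite !residue_map_residue -rmorphM; congr residue; apply: val_inj.
by rewrite val_ring_inclusion !rmorphM.
Qed.

Lemma immediate_residue_map_surj : immediate j w ->
  forall t, exists s, residue_map j v w s = t.
Proof.
move=> imm; elim/quotW=> r; rewrite -/(residue r).
(* Immediacy speaks of nonzero elements only, so a zero representative is treated apart. *)
have [r0|r0] := eqVneq (val r) 0.
  exists (residue 0); rewrite residue_map_residue; congr residue; apply: val_inj.
  by rewrite val_ring_inclusion !raddf0 r0.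
have [k k0 rk] := imm _ r0.
have jk0 : j k != 0 by rewrite fmorph_eq0.
have vk : k \in in_valuation_ring v.
  rewrite unfold_in /in_valuation_ring -jvw -(one_unit_valE jk0 rk).
  exact: (valP r).
pose a : valuation_ring v := Sub k vk.
exists (residue a); rewrite residue_map_residue; apply/residue_eqP; rewrite /= valuationBC.
apply: le_lt_trans ((one_unit_divP _ _ _).1 rk); last by [].
by rewrite jvw.
Qed.

(** Every residue comes from some [s] below, so the nonzero polynomial ['X - s] vanishes at it. *)
Lemma immediate_not_residue_transcendental : immediate j w ->
  ~ residue_transcendental j v w.
Proof.
move=> imm [[t t_indep] _].
have [s st] := immediate_residue_map_surj imm (t ord0).
pose h : {rmorphism residue_field v -> residue_field w} :=
  HB.pack (residue_map j v w)
    (GRing.isZmodMorphism.Build _ _ _ residue_map_zmod_morphism)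
    (GRing.isMonoidMorphism.Build _ _ _ residue_map_monoid_morphism).
have /t_indep/(congr1 (mcoeff U_(ord0))) :
    mmap (residue_map j v w) t ('X_ord0 - s%:MP_[1]) = 0.
  by rewrite -[residue_map j v w]/(h : _ -> _) mmapB mmapC mmapX mmap1U /= st subrr.
rewrite mcoeffB mcoeffX mcoeffC eqxx mcoeff0 mnm1_eq0 mulr0 subr0 => /eqP.
by rewrite oner_eq0.
Qed.

End ResidueMap.

(** * Simple algebraic extensions and their degrees *)

Section SimpleExtension.
Variables (K L : fieldType) (iota : {rmorphism K -> L}).
Local Notation "q ^iota" := (map_poly iota q) (at level 2, format "q ^iota").

Lemma adjoin_horner a (q : {poly K}) : adjoin iota a q^iota.[a].
Proof.
move=> S divS KS aS.
have subS := GRing.divring_closedBM divS.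
elim/poly_ind: q => [|q c IH].
  by rewrite rmorph0 horner0 -(rmorph0 iota) KS.
(* The closure property of [S] is about differences, so the sum is written as one. *)
rewrite rmorphD rmorphM/= map_polyX map_polyC/= hornerMXaddC -[iota c]opprK -rmorphN.
have [_ S_B S_M] := subS.
by apply: S_B => //; apply: S_M.
Qed.

Lemma algebraic_minimal_poly a : algebraicOver iota a ->
  exists p : {poly K}, [/\ p != 0, root p^iota a &
    forall q : {poly K}, q != 0 -> root q^iota a -> (size p <= size q)%N].
Proof.
case=> q q0 qa.
pose P n := `[< exists p : {poly K}, [/\ p != 0, root p^iota a & size p = n] >].
have exP : exists n, P n by exists (size q); apply/asboolP; exists q.
case: (ex_minnP exP) => n /asboolP[p [p0 pa <-]] min_p.
exists p; split=> // r r0 ra; apply: min_p; apply/asboolP.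
by exists r.
Qed.

(* The polynomial of least degree among those vanishing at [a] is coprime to
   every polynomial not vanishing at [a], which makes K[a] a field. *)
Lemma adjoin_polyP a u : algebraicOver iota a ->
  adjoin iota a u <-> exists q : {poly K}, u = q^iota.[a].
Proof.
move=> /algebraic_minimal_poly[p [p0 pa min_p]].
split=> [|[q ->]]; last exact: adjoin_horner.
move=> /(_ [pred u | `[< exists q : {poly K}, u = q^iota.[a] >]]) h.
apply/asboolP/h => [|c|].
- split=> [|_ _ /asboolP[q ->] /asboolP[r ->]|_ _ /asboolP[q ->] /asboolP[r ->]];
    apply/asboolP.
  + by exists 1; rewrite rmorph1 hornerC.
  + by exists (q - r); rewrite rmorphB hornerE hornerN.
  + have [ra0|ra0] := eqVneq r^iota.[a] 0.
      by exists 0; rewrite ra0 invr0 mulr0 rmorph0 horner0.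
    have /Bezout_eq1_coprimepP[[s t] /= st] : coprimep p r.
      rewrite /coprimep; have dp := dvdp_gcdl p r; have dr := dvdp_gcdr p r.
      set g := gcdp p r in dp dr *; have g0 : g != 0 by rewrite gcdp_eq0 negb_and p0.
      (* [g] divides [r], so it does not vanish at [a]; then [p %/ g] does, and minimality of [p]
         forces [g] to be constant. *)
      have g_root : ~~ root g^iota a.
        apply: contra ra0 => ga; rewrite -[_ == 0]/(root _ _).
        by rewrite -(divpK dr) rmorphM rootM ga orbT.
      have /divpK pE := dp.
      have k0 : p %/ g != 0 by apply: contraNneq p0 => k0; rewrite -pE k0 mul0r.
      have := min_p (p %/ g) k0; rewrite size_divp//.
      have -> : root (p %/ g)^iota a.
        by move: pa; rewrite -{1}pE rmorphM rootM (negPf g_root) orbF.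
      have := size_poly_gt0 p; rewrite p0; have := size_poly_gt0 g; rewrite g0.
      case: (size p) (size g) => [//|m] [//|[//|n]] _ _ /(_ isT).
      by rewrite subSS ltnNge leq_subr.
    exists (q * t); rewrite rmorphM hornerM; congr (_ * _).
    apply: (mulIf ra0); rewrite mulVf// -hornerM -rmorphM.
    have := congr1 (fun q => q^iota.[a]) st.
    rewrite rmorphD rmorphM hornerD hornerM/= (rootP pa) mulr0 add0r => ->.
    by rewrite rmorph1 hornerC.
- by apply/asboolP; exists c%:P; rewrite map_polyC hornerC.
- by apply/asboolP; exists 'X; rewrite map_polyX hornerX.
Qed.

(** The powers of [a] below the degree of a minimal polynomial form a basis: division by it gives
    spanning, minimality gives independence. *)
Lemma ext_degree_exists a : algebraicOver iota a -> exists n, ext_degree iota a n.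
Proof.
move=> a_alg; have [p [p0 pa min_p]] := algebraic_minimal_poly a_alg.
exists (size p).-1, (fun i => a ^+ i).
have evalE (q : {poly K}) : (size q <= (size p).-1)%N ->
    q^iota.[a] = \sum_(i < (size p).-1) iota q`_i * a ^+ i.
  move=> sq; rewrite (@horner_coef_wide _ (size p).-1) ?size_map_poly//.
  by apply: eq_bigr => i _; rewrite coef_map.
split=> [c c0 i|u].
  pose q := rVpoly (\row_i c i).
  have sq : (size q <= (size p).-1)%N by apply: size_poly.
  have qE k : q`_(nat_of_ord k) = c k by rewrite coef_rVpoly_ord mxE.
  have [q0|q0] := eqVneq q 0; first by rewrite -qE q0 coef0.
  have /(min_p q q0) : root q^iota a.
    apply/rootP; rewrite evalE// -[RHS]c0; apply: eq_bigr => k _.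
    by rewrite qE.
  move/leq_trans/(_ sq); rewrite leqNgt ltn_predL size_poly_gt0 p0//.
rewrite adjoin_polyP//; split=> [[q ->]|[c ->]].
  exists (fun i => (q %% p)`_i); rewrite -evalE.
    rewrite {1}(divp_eq q p) rmorphD rmorphM hornerD hornerM/= (rootP pa).
    by rewrite mulr0 add0r.
  by rewrite -ltnS prednK ?size_poly_gt0// ltn_modp.
exists (rVpoly (\row_i c i)); rewrite evalE ?size_poly//.
by apply: eq_bigr => i _; rewrite coef_rVpoly_ord mxE.
Qed.

Lemma ext_degree_base c : ext_degree iota (iota c) 1.
Proof.
exists (fun=> 1); split=> [k|u].
  by rewrite big_ord1 mulr1 => /eqP; rewrite fmorph_eq0 => /eqP k0 i; rewrite ord1.
split=> [h|[k ->]]; last by rewrite big_ord1 mulr1 => S _ + _; apply.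
suff /asboolP[k ->] : u \in [pred u | `[< exists k, u = iota k >]].
  by exists (fun=> k); rewrite big_ord1 mulr1.
apply: h => [|k|]; last 2 first.
- by apply/asboolP; exists k.
- by apply/asboolP; exists c.
split=> [|_ _ /asboolP[k ->] /asboolP[l ->]|_ _ /asboolP[k ->] /asboolP[l ->]];
  apply/asboolP.
+ by exists 1; rewrite rmorph1.
+ by exists (k - l); rewrite rmorphB.
+ by exists (k / l); rewrite fmorph_div.
Qed.

(** Both [1] and [a] are multiples of the single basis element, so [a] is a quotient of
    coefficients; an empty basis would give [1 = 0]. *)
Lemma ext_degree_le1 a n : ext_degree iota a n -> (n <= 1)%N ->
  exists c, a = iota c.
Proof.
move=> [e [_ span]] n1.
have [k1 E1] : exists k : 'I_n -> K, 1 = \sum_i iota (k i) * e i.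
  by apply/span => S [].
have [ka Ea] : exists k : 'I_n -> K, a = \sum_i iota (k i) * e i.
  by apply/span => S _ _.
case: n n1 e k1 ka {span} E1 Ea => [|[|//]] _ e k1 ka.
  by rewrite big_ord0 => /eqP; rewrite oner_eq0.
rewrite !big_ord1 => E1 Ea; exists (ka ord0 / k1 ord0).
have k0 : iota (k1 ord0) != 0.
  by apply: contra_eq_neq E1 => ->; rewrite mul0r oner_eq0.
rewrite fmorph_div Ea; congr (_ * _); apply: (mulfI k0).
by rewrite -E1 mulfV.
Qed.

End SimpleExtension.

(** * Fractions and the transfer of limits along extensions *)

HB.instance Definition _ (F : fieldType) :=
  GRing.RMorphism.copy (@ratfun_const F) (@FracField.tofrac {poly F} \o polyC).

Lemma divf_mull2 (F : fieldType) (a x y : F) : a != 0 -> a * x / (a * y) = x / y.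
Proof. by move=> a0; rewrite -mulf_div divff// mul1r. Qed.

Lemma divf_divf_swap (F : fieldType) (a b x y : F) :
  (x / y) / (a / b) = (x / a) / (y / b).
Proof. by rewrite !invf_div !mulf_div [y * a]mulrC. Qed.

Section LimitTransfer.
Variables (K L L' : fieldType) (G : orderedGroupType).
Variables (nu : valuation K G) (w : valuation L G) (w' : valuation L' G).
Variables (d : Order.disp_t) (I : orderType d) (I_limit : limit_well_order I).
Variables (z : I -> K) (z_pc : pseudo_cauchy nu z).
Variables (j : {rmorphism K -> L}) (h : {rmorphism L -> L'}).
Hypotheses (jw : extends j nu w) (hw : extends h w w').

Lemma pseudo_cauchy_map : pseudo_cauchy w' (fun i => h (j (z i))).
Proof. by move=> i1 i2 i3 i12 i23; rewrite -!rmorphB !hw !jw z_pc. Qed.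

(** Moves the question to [L'], where limits from different extensions of [K] can be compared. *)
Lemma is_limit_map l :
  is_limit nu z j w l <-> pseudo_limit w' (fun i => h (j (z i))) (h l).
Proof.
apply: iff_trans (iff_sym (pseudo_limitP I_limit pseudo_cauchy_map (h l))).
by split=> H i i' /H; rewrite -!rmorphB !hw jw.
Qed.

End LimitTransfer.

(** * Limits, pairs of definition and key polynomials for rational function fields *)

Section RationalFunctions.
Variables (G : orderedGroupType).
Variables (K : fieldType) (Kbar : closedFieldType) (iota : {rmorphism K -> Kbar}).
Variables (nu : valuation K G) (nubar : valuation Kbar G).
Variables (omega : valuation (ratfun K) G) (omegabar : valuation (ratfun Kbar) G).
Hypotheses (omega_nu : extends (@ratfun_const K) nu omega).
Hypotheses (nubar_nu : extends iota nu nubar).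
Hypotheses (omegabar_nubar : extends (@ratfun_const Kbar) nubar omegabar).
Hypotheses (omegabar_omega : extends (ratfun_map iota) omega omegabar).
Variables (d : Order.disp_t) (I : orderType d) (I_limit : limit_well_order I).
Variables (z : I -> K) (z_pc : pseudo_cauchy nu z).

Local Notation Y := (fun i => ratfun_const (iota (z i))).
Local Notation X := ('X%:F : ratfun Kbar).
Local Notation const := (@ratfun_const Kbar).
Local Notation "q ^iota" := (map_poly iota q) (at level 2, format "q ^iota").

Lemma ratfun_map_poly (p : {poly K}) : ratfun_map iota p%:F = (p^iota)%:F.
Proof.
by rewrite -[p%:F]divr1 -tofrac1 ratfun_mapE ?oner_neq0// rmorph1 tofrac1 divr1.
Qed.

Lemma ratfun_map_const c : ratfun_map iota (ratfun_const c) = const (iota c).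
Proof. by rewrite [LHS]ratfun_map_poly map_polyC. Qed.

Lemma ratfun_XsubC c : ('X - c%:P)%:F = X - const c.
Proof. exact: tofracB. Qed.

Lemma terms_pc : pseudo_cauchy omegabar Y.
Proof. exact (pseudo_cauchy_map z_pc nubar_nu omegabar_nubar). Qed.

Lemma is_limit_const c :
  is_limit nu z iota nubar c <-> pseudo_limit omegabar Y (const c).
Proof. exact: is_limit_map. Qed.

Lemma is_limit_X :
  is_limit nu z (@ratfun_const K) omega 'X%:F <-> pseudo_limit omegabar Y X.
Proof.
apply: iff_trans (is_limit_map I_limit z_pc omega_nu omegabar_omega _) _.
rewrite /= ratfun_map_poly map_polyX.
suff -> : (fun i => ratfun_map iota (ratfun_const (z i))) = Y by [].
by apply: funext => i; rewrite ratfun_map_const.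
Qed.

(** Splitting [f] over [Kbar] turns its values at [x] and at elements of [K] into products over the
    same roots. *)
Lemma poly_roots (f : {poly K}) : f != 0 ->
  exists (a : Kbar) (rs : seq Kbar),
  [/\ a != 0, forall c, root f^iota c = (c \in rs),
      ratfun_map iota f%:F = const a * root_prod (map const rs) X &
      forall u : K, ratfun_map iota (ratfun_const f.[u]) =
        const a * root_prod (map const rs) (const (iota u))].
Proof.
move=> f0; have f0' : lead_coef f^iota != 0 by rewrite lead_coef_eq0 map_poly_eq0.
have [rs fE] := closed_field_poly_normal f^iota.
exists (lead_coef f^iota), rs; split=> // [c||u].
- by rewrite fE rootZ// root_prod_XsubC.
- rewrite ratfun_map_poly {1}fE -mul_polyC tofracM; congr (_ * _).
  rewrite /root_prod big_map rmorph_prod/=.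
  by apply: eq_bigr => c _; rewrite ratfun_XsubC.
- rewrite ratfun_map_const -horner_map {1}fE hornerZ rmorphM; congr (_ * _).
  rewrite /root_prod big_map horner_prod rmorph_prod.
  by apply: eq_bigr => c _; rewrite hornerXsubC rmorphB.
Qed.

Lemma nu_horner (u : K) (f : {poly K}) :
  nu f.[u] = omegabar (ratfun_map iota (ratfun_const f.[u])).
Proof. by rewrite omegabar_omega omega_nu. Qed.

Lemma increasing_of_limit_root (f : {poly K}) c : f != 0 -> root f^iota c ->
  pseudo_limit omegabar Y (const c) -> ultimately_increasing nu z f.
Proof.
move=> /poly_roots[a [rs [a0 rootE _ fE]]]; rewrite rootE => crs c_lim.
have [i0 h] := root_prod_increasing I_limit terms_pc (map_f const crs) c_lim.
exists i0 => i j i0i ij; rewrite !nu_horner !fE !valuationM.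
rewrite addrC [X in _ < X]addrC; apply: ltD_withtop (lexx _); last exact: h.
by rewrite valuation_neq_infty fmorph_eq0.
Qed.

Lemma constant_of_no_limit_root (f : {poly K}) :
  (forall c, root f^iota c -> ~ pseudo_limit omegabar Y (const c)) ->
  ultimately_constant nu z f.
Proof.
have [-> _|f0 nolim] := eqVneq f 0.
  have [i _] := limit_order_inhabited I_limit.
  by exists i => k _; rewrite !horner0.
have [a [rs [a0 rootE _ fE]]] := poly_roots f0.
have [|i0 h] := root_prod_constant I_limit terms_pc (rs := map const rs).
  by move=> _ /mapP[c crs ->]; apply: nolim; rewrite rootE.
exists i0 => i i0i.
by rewrite !nu_horner !fE !valuationM (h i).
Qed.

Lemma increasing_not_constant (f : {poly K}) :
  ultimately_increasing nu z f -> ~ ultimately_constant nu z f.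
Proof.
move=> [i incr] [j const]; pose k := Order.max i j.
have [l kl] := limit_order_unbounded I_limit k.
have [ik jk] : (i <= k)%O /\ (j <= k)%O by rewrite !le_max !lexx orbT.
have := incr _ _ ik kl.
by rewrite (const _ jk) (const _ (ltW (le_lt_trans jk kl))) ltxx.
Qed.

(** Numerator and denominator are each approximated by their values at [z i]; being a limit, [x] is
    close to every term, so [root_prod_one_unit] applies. *)
Lemma immediate_of_no_limit : pseudo_limit omegabar Y X ->
  (forall c, ~ pseudo_limit omegabar Y (const c)) ->
  immediate (@ratfun_const K) omega.
Proof.
move=> X_lim nolim.
have approx (f : {poly K}) : f != 0 -> exists i0, forall i, (i0 <= i)%O ->
    f.[z i] != 0 /\ one_unit omega (f%:F / ratfun_const f.[z i]).
  move=> /poly_roots[a [rs [a0 _ fX fz]]].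
  have [|i0 h] := root_prod_one_unit I_limit terms_pc (rs := map const rs).
    by move=> _ /mapP[c crs ->]; apply: nolim.
  have a0' : const a != 0 by rewrite fmorph_eq0.
  exists i0 => i /h[P0 /(_ _ (close_to_limit X_lim (i := i))) P1].
  have fz0 : f.[z i] != 0.
    by apply: contra_neq (mulf_neq0 a0' P0) => u0; rewrite -fz u0 !rmorph0.
  split=> //; rewrite /one_unit -omegabar_omega rmorphB rmorph1 fmorph_div/=.
  by rewrite fX fz (divf_mull2 _ _ a0').
move=> h h0; have q0 := denom_ratioP (repr h); move: h0; rewrite [h]frac_repr.
move: (\n_(repr h)) (\d_(repr h)) q0 => p q q0 pq0.
have p0 : p != 0 by apply: contraNneq pq0 => ->; rewrite tofrac0 mul0r.
have [i1 h1] := approx p p0; have [i2 h2] := approx q q0.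
pose i := Order.max i1 i2.
have [i1i i2i] : (i1 <= i)%O /\ (i2 <= i)%O by rewrite !le_max !lexx orbT.
have [[P0 P1] [Q0 Q1]] := (h1 i i1i, h2 i i2i).
exists (p.[z i] / q.[z i]); first by rewrite mulf_neq0// invr_eq0.
rewrite fmorph_div divf_divf_swap.
exact: one_unitM P1 (one_unitV Q1).
Qed.

Lemma pair_of_definition_XsubC a gamma c :
  pair_of_definition nubar omegabar a gamma ->
  omegabar (X - const c) = Num.min (nubar (a - c)) (fin gamma).
Proof.
(* The expansion [(a - c) + 1 * (x - a)] of [x - c] has two coefficients. *)
case=> _ /(_ 2 (fun i => if val i == 0 then a - c else 1)).
rewrite !big_ord_recl !big_ord0 /= expr0 expr1 mulr1 mul1r !addr0 mulr1n polyCB.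
have -> : a%:P - c%:P + ('X - a%:P) = 'X - c%:P by rewrite addrC subrKA.
by rewrite ratfun_XsubC valuation1 add0r => ->.
Qed.

(** The values of [x - z_j] increase strictly and are bounded by [gamma], so the minimum giving the
    value of [x - z_i] is attained by [a - z_i] alone. *)
Lemma pair_of_definition_is_limit a gamma :
  pseudo_limit omegabar Y X -> pair_of_definition nubar omegabar a gamma ->
  is_limit nu z iota nubar a.
Proof.
move=> X_lim ag; apply/is_limit_const => i j ij.
rewrite -(X_lim _ _ ij) (pair_of_definition_XsubC _ ag) -rmorphB omegabar_nubar.
have [k jk] := limit_order_unbounded I_limit j.
have : omegabar (X - Y i) < fin gamma.
  rewrite (X_lim _ _ ij); apply: lt_le_trans (terms_pc ij jk) _.
  by rewrite -(X_lim _ _ jk) (pair_of_definition_XsubC _ ag) ge_min lexx orbT.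
by rewrite (pair_of_definition_XsubC _ ag) gt_min ltxx orbF => /ltW/min_l ->.
Qed.

(** Otherwise [gamma] is below the value of some [a - z_i], and minimality, tested on [z_i], makes
    the degree of [a] at most 1. Then the limit [a] lies in [K]. *)
Lemma minimal_pair_X_limit (Kbar_algebraic : forall u, algebraicOver iota u) a gamma :
  ~ (exists l : K, is_limit nu z idfun nu l) ->
  minimal_pair_of_definition iota nubar omegabar a gamma ->
  is_limit nu z iota nubar a -> pseudo_limit omegabar Y X.
Proof.
move=> z_nolim [ag a_min] /[dup] a_lim /is_limit_const a_lim' i j ij.
rewrite (pair_of_definition_XsubC _ ag) -(a_lim' _ _ ij) -rmorphB omegabar_nubar.
apply: min_l; rewrite leNgt; apply/negP => /ltW/a_min a_deg.
have [n an] := ext_degree_exists (Kbar_algebraic a).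
have [l al] := ext_degree_le1 an (a_deg _ _ an (ext_degree_base iota (z i))).
apply: z_nolim; exists l => k k' kk'.
by rewrite -(a_lim _ _ kk') al -rmorphB nubar_nu.
Qed.

(** Comparing [Q] with the linear polynomial ['X - z_i] shows that [x - b] has larger value than
    [x - z_i], so subtracting it preserves the value. *)
Lemma key_polynomial_root_is_limit (Q : {poly K}) b :
  pseudo_limit omegabar Y X -> key_polynomial iota omegabar Q -> size Q != 2%N ->
  maximal_root iota omegabar Q b -> is_limit nu z iota nubar b.
Proof.
move=> X_lim [_ Q1 Q_key] Q2 [_ Qb]; apply/is_limit_const => i j ij.
rewrite -(X_lim _ _ ij).
have -> : const b - Y i = (X - Y i) - (X - const b) by rewrite opprB [RHS]addrC subrKA.
have E : map_poly iota ('X - (z i)%:P) = 'X - (iota (z i))%:P.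
  by rewrite rmorphB /= map_polyX map_polyC.
have linear_delta : is_delta iota omegabar ('X - (z i)%:P) (omegabar (X - Y i)).
  rewrite /is_delta E; split=> [|c]; last first.
    by rewrite root_XsubC => /eqP ->; rewrite ratfun_XsubC.
  by exists (iota (z i)); rewrite ?root_XsubC ?ratfun_XsubC.
have size_lin : (1 < size ('X - (z i)%:P)%R < size Q)%N.
  by rewrite size_XsubC /= ltn_neqAle eq_sym Q2.
have := Q_key _ size_lin _ _ linear_delta Qb; rewrite ratfun_XsubC.
exact: valuationB_lt.
Qed.

(** Some root of [m] is a limit, but no root of a nonconstant [f] of smaller degree is. Some gap
    therefore separates the roots of [f] from that of [m]. *)
Lemma minimal_polynomial_key (m : {poly K}) :
  pseudo_limit omegabar Y X -> associated_minimal_polynomial nu z m ->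
  key_polynomial iota omegabar m.
Proof.
move=> X_lim [_ m_monic m_incr m_min].
have [c mc c_lim] : exists2 c, root m^iota c & pseudo_limit omegabar Y (const c).
  apply: contrapT => none; apply: (increasing_not_constant m_incr).
  apply: constant_of_no_limit_root => c mc c_lim.
  by apply: none; exists c.
have m1 : (1 < size m)%N.
  have := root_size_gt1 _ mc; rewrite map_poly_eq0 size_map_poly; apply.
  exact: monic_neq0.
split=> // f /andP[f1 fm] df dm [[a fa <-] _] [_ /(_ c mc)]; apply: lt_le_trans.
have f0 : f != 0 by rewrite -size_poly_gt0 ltnW.
have a_nlim : ~ pseudo_limit omegabar Y (const a).
  move=> /(increasing_of_limit_root f0 fa)[i0 h].
  (* Minimality of [m] is tested on monic polynomials, so [f] is rescaled. *)
  have lf0 : (lead_coef f)^-1 != 0 by rewrite invr_eq0 lead_coef_eq0.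
  have /m_min : (lead_coef f)^-1 *: f \is monic.
    by rewrite monicE lead_coefZ mulVf ?lead_coef_eq0.
  rewrite size_scale// leqNgt fm => /(_ _)/negP; case=> //; exists i0 => i j i0i ij.
  rewrite !hornerZ !valuationM addrC [X in _ < X]addrC.
  by apply: ltD_withtop; rewrite ?h// (valuation_neq_infty nu).
have [i [j [ij a_lt]]] := lt_not_pseudo_limit I_limit terms_pc X_lim a_nlim.
rewrite !ratfun_XsubC; apply: lt_trans a_lt _.
exact (lt_pseudo_limits I_limit terms_pc X_lim c_lim ij).
Qed.

(** A limit in [Kbar] would make a nonzero polynomial vanishing at it ultimately increasing.
    Transcendental type thus excludes such limits and makes the extension immediate. *)
Lemma algebraic_type_of_limit (Kbar_algebraic : forall u, algebraicOver iota u) :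
  valuation_transcendental (@ratfun_const K) nu omega ->
  pseudo_limit omegabar Y X -> algebraic_type nu z.
Proof.
move=> vt X_lim trans.
have imm : immediate (@ratfun_const K) omega.
  apply: immediate_of_no_limit X_lim _ => c c_lim.
  have [p p0 pc] := Kbar_algebraic c.
  exact: increasing_not_constant (increasing_of_limit_root p0 pc c_lim) (trans p).
case: vt; first exact: immediate_not_value_transcendental.
exact: immediate_not_residue_transcendental.
Qed.

End RationalFunctions.

Theorem theorem9p2
    (G : orderedGroupType)
    (K : fieldType) (Kbar : closedFieldType) (iota : {rmorphism K -> Kbar})
    (Kbar_algebraic : forall u, algebraicOver iota u)
    (nu : valuation K G) (nubar : valuation Kbar G)
    (omega : valuation (ratfun K) G) (omegabar : valuation (ratfun Kbar) G)
    (omega_nu : extends (@ratfun_const K) nu omega)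
    (nubar_nu : extends iota nu nubar)
    (omegabar_nubar : extends (@ratfun_const Kbar) nubar omegabar)
    (omegabar_omega : extends (ratfun_map iota) omega omegabar)
    (omega_vt : valuation_transcendental (@ratfun_const K) nu omega)
    (d : Order.disp_t) (I : orderType d) (I_limit : limit_well_order I)
    (z : I -> K) (z_pc : pseudo_cauchy nu z)
    (z_nolim : ~ exists l : K, is_limit nu z idfun nu l) :
  (is_limit nu z (@ratfun_const K) omega 'X%:F ->
    [/\ algebraic_type nu z,
        forall (a : Kbar) (gamma : G),
          pair_of_definition nubar omegabar a gamma ->
          is_limit nu z iota nubar a,
        forall (Q : {poly K}) (b : Kbar),
          key_polynomial iota omegabar Q -> size Q != 2%N ->
          maximal_root iota omegabar Q b ->
          is_limit nu z iota nubar b &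
        forall m : {poly K},
          associated_minimal_polynomial nu z m ->
          key_polynomial iota omegabar m])
  /\
  (forall (a : Kbar) (gamma : G),
    minimal_pair_of_definition iota nubar omegabar a gamma ->
    is_limit nu z iota nubar a ->
    is_limit nu z (@ratfun_const K) omega 'X%:F).
Proof.
split=> [/(is_limit_X omega_nu omegabar_omega I_limit z_pc) X_lim|a gamma ag a_lim].
  split=> [|a gamma|Q b|m].
  - exact: algebraic_type_of_limit X_lim.
  - exact: pair_of_definition_is_limit X_lim.
  - exact: key_polynomial_root_is_limit X_lim.
  - exact: minimal_polynomial_key X_lim.
apply/(is_limit_X omega_nu omegabar_omega I_limit z_pc).
exact: minimal_pair_X_limit ag a_lim.
Qed.
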